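(* Let $t_n$ be the number of rays of the submodular cone $\mathbb{SC}_n$. For all $n\ge 4$, $t_n\le n^{2^n}$.
   Context: A set function $f:2^{[n]}\to\mathbb{R}$ is submodular if $f(A)+f(B)\ge f(A\cup B)+f(A\cap B)$ for all $A,B\subseteq[n]$. The submodular cone $\mathbb{SC}_n$ is the cone of submodular functions $f:2^{[n]}\to\mathbb{R}$; its rays are counted after quotienting by modular functions (i.e. rays of the pointed cone obtained by quotienting by the lineality space). Equivalently, $\mathbb{SC}_n$ is the cone (under Minkowski sum and dilation) of deformed $n$-permutahedra, i.e. polytopes in $\mathbb{R}^n$ all of whose edges are parallel to vectors $e_i-e_j$, with lineality space given by translations; rays correspond to deformed $n$-permutahedra that are not points and are Minkowski indecomposable ($P=Q+R$ implies that $Q$ and $R$ are translated dilates of $P$), up to translation and positive dilation. *)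

(* Defs.v *)
From mathcomp Require Import all_boot all_order all_algebra.
From mathcomp Require Import finmap.
From mathcomp Require Import boolp classical_sets functions cardinality reals.

Set Implicit Arguments.
Unset Strict Implicit.
Unset Printing Implicit Defensive.

Import Order.TTheory GRing.Theory Num.Theory.

Local Open Scope classical_set_scope.
Local Open Scope ring_scope.

Section QuotientRays.
Variables (R : realType) (V : lmodType R).

(* For L a linear subspace of V, the elements of V / L are represented by the
   cosets v + L, so that equality and linear operations in V / L read
   [coset L u = coset L v], [coset L (u + v)] and [coset L (a *: v)]. *)
Definition coset (L : set V) (v : V) : set V := [set w | L (w - v)].

Definition half_line (L : set V) (v : V) : set (set V) :=
  [set coset L (a *: v) | a in [set a : R | 0 <= a]].

(* v + L spans a ray (one-dimensional face) of the image of the cone C in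
   V / L, L being the lineality space of C. *)
Definition spans_ray (C L : set V) (v : V) : Prop :=
  [/\ C v, coset L v <> coset L 0 &
   forall u w : V, C u -> C w -> coset L (u + w) = coset L v ->
     half_line L v (coset L u) /\ half_line L v (coset L w)].

Definition rays (C L : set V) : set (set (set V)) :=
  [set half_line L v | v in [set v | spans_ray C L v]].

End QuotientRays.

Section Submodular.
Variables (R : realType) (n : nat).

(* R^o makes R a module over itself, hence the type below an lmodType R. *)
Definition set_function : lmodType R := {ffun {set 'I_n} -> R^o}.

Definition submodular_cone : set set_function :=
  [set f : {ffun {set 'I_n} -> R} |
    forall A B : {set 'I_n}, f A + f B >= f (A :|: B) + f (A :&: B)].

Definition modular_functions : set set_function :=
  [set f : {ffun {set 'I_n} -> R} |
    forall A B : {set 'I_n}, f A + f B = f (A :|: B) + f (A :&: B)].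

Definition submodular_rays : set (set (set set_function)) :=
  rays submodular_cone modular_functions.

(* [fset_set] of an infinite set is empty, so this is the number of rays only
   together with [finite_set submodular_rays]. *)
Definition num_submodular_rays : nat := #|` fset_set submodular_rays|%fset.

End Submodular.

Arguments submodular_cone : clear implicits.
Arguments modular_functions : clear implicits.
Arguments submodular_rays : clear implicits.
Arguments num_submodular_rays : clear implicits.

(* Main.v *)
Require Import Defs.
From HB Require Import structures.
From mathcomp Require Import all_boot all_order all_algebra.
From mathcomp Require Import finmap ring lra zify.
From mathcomp Require Import boolp classical_sets functions cardinality reals.

(** The submodular cone is cut out by the local inequalities
    [f (i |: S) + f (j |: S) >= f (i |: (j |: S)) + f S] with [i <> j] outside
    [S]; there are ['C(n, 2) * 2 ^ (n - 2)] of them, in a space of dimension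
    [2 ^ n].  Choosing a set of tight inequalities of full rank for each ray
    would give about [n ^ (2 * 2 ^ n)] rays; the bound needs the square root of
    this, that is, a ray must be encoded by half as many inequalities.  This is
    the asymptotic form of the upper bound theorem for polytopes, and it has a
    short proof ([card_rays_le]).

    Let [C] be the cone of the inequalities [a i >= 0], [L] its lineality space,
    and [height] the sum of the [a i], which is positive on [C] outside [L]; the
    rays are then the vertices of the slice [height = 1].  Fix a generic linear
    combination [c] of the [a i].  At a ray spanned by [x], take an
    inclusion-minimal set [B] of tight inequalities whose common zero set is
    [x]'s line modulo [L].  On [C] one has
    [c = mu * height + \sum_(i in B) lam i * a i], where no [lam i] vanishes
    because [c] is generic ([ray_expansion]).  Let [N] be the set of the [i] in
    [B] with [lam i < 0].  On the face of the slice where the [a i] with [i] in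
    [N] vanish, [c] is minimal exactly at [x], so that [N] determines the ray.
    With the positive [lam i] in place of the negative ones, [x] becomes the
    unique maximum.  One of the two sets has at most [#|B|./2] elements, so
    every ray is determined by a sign and a small set of inequalities
    ([ray_optimal], [optimal_half_line]).

    For [k = 2 ^ n.-1] and [m] inequalities this gives at most
    [2 * 'C(m + k, k)] rays.  Since [4 * (m + k) = (n * n.-1 + 4) * k] is at most
    [n ^ 2 * k] as soon as [n >= 4], and [2 * k ^ k <= 4 ^ k * k`!], this number
    is at most [n ^ (2 * k)] ([double_bin_le_expn]). *)

Set Implicit Arguments.
Unset Strict Implicit.
Unset Printing Implicit Defensive.

Import Order.TTheory GRing.Theory Num.Theory.

Local Open Scope ring_scope.

(** * Counting and genericity *)

Lemma inj_in_card_fset_set (T : choiceType) (F : finType) (A : set T)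
    (D : {set F}) (f : T -> F) :
  (forall x, A x -> f x \in D) -> {in A &, injective f} ->
  finite_set A /\ (#|` fset_set A| <= #|D|)%N.
Proof.
move=> fD f_inj; pose g x := index (f x) (enum D).
have g_inj : {in A &, injective g}.
  move=> x y Ax Ay /(congr1 (nth (f x) (enum D))).
  have inD z : z \in A -> f z \in enum D by rewrite mem_enum => /set_mem/fD.
  by rewrite !nth_index ?inD //; exact: f_inj.
have leA : (A #<= `I_#|D|%classic)%card.
  rewrite -(card_le_eql (inj_card_eq g_inj)); apply: subset_card_le => _ [x Ax <-].
  by rewrite /= /g cardE index_mem mem_enum; exact: fD.
by split; [exact: card_le_finite leA (finite_II _) | exact: geq_card_fset_set].
Qed.

(** By Vandermonde's identity the right-hand side counts the sets of size
    exactly [k] in [I] enlarged by [k] dummy elements, and every set of size at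
    most [k] can be padded with dummies. *)
Lemma card_small_sets (I : finType) (k : nat) :
  (#|[set N : {set I} | (#|N| <= k)%N]%SET| <= 'C(#|I| + k, k))%N.
Proof.
rewrite -binomial.Vandermonde -sum1_card.
rewrite (partition_big (fun N : {set I} => inord #|N| : 'I_k.+1) xpredT) //=.
apply: leq_sum => j _; have jk : (j <= k)%N by rewrite -ltnS.
apply: (@leq_trans 'C(#|I|, j)); last by rewrite leq_pmulr // bin_gt0 leq_subr.
rewrite sum1_card -card_draws; apply/subset_leq_card/fintype.subsetP => N.
by rewrite unfold_in !inE /= => /andP[Nk /eqP <-]; rewrite inordK.
Qed.

Lemma poly_exists_nonroot (R : numDomainType) (p : {poly R}) :
  p != 0 -> exists t, p.[t] != 0.
Proof.
move=> p0; apply: contrapT => /forallNP all_root.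
have := @max_poly_roots _ p [seq i%:R | i <- iota 0 (size p)] p0.
rewrite size_map size_iota ltnn => H; suff : false by []; apply: H.
  by apply/allP => x _; rewrite rootE; have /negP := all_root x; rewrite negbK.
by rewrite map_inj_uniq ?iota_uniq// => i j /eqP; rewrite eqr_nat => /eqP.
Qed.

(** Taking the [g i] to be successive powers of a single parameter [t] turns each
    of the sums into a polynomial in [t]; a [t] which is a root of none of the
    nonzero ones will do. *)
Lemma generic_coefficients (R : numDomainType) (I J : finType) (w : J -> I -> R) :
  exists g : I -> R, forall j, (exists i, w j i != 0) ->
    \sum_i g i * w j i != 0.
Proof.
pose p j : {poly R} := \sum_i w j i *: 'X^(enum_rank i).
have p_neq0 j : (exists i, w j i != 0) -> p j != 0.
  case=> i wji; apply/eqP => /(congr1 (fun q : {poly R} => q`_(enum_rank i))).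
  rewrite coef_sum coef0 (bigD1 i) //= big1 => [|i' ne]; rewrite coefZ coefXn.
    by rewrite eqxx mulr1 addr0 => /eqP; rewrite (negPf wji).
  rewrite [_ == _](_ : _ = false) ?mulr0 //.
  apply/negP => /eqP/ord_inj/enum_rank_inj.
  by move/eqP; rewrite eq_sym (negPf ne).
have [|t] := @poly_exists_nonroot _ (\prod_(j | p j != 0) p j).
  by apply/prodf_neq0.
rewrite horner_prod => /prodf_neq0 nz.
exists (fun i => t ^+ enum_rank i) => j /p_neq0/nz.
apply: contraNN => /eqP sum0; apply/eqP; rewrite horner_sum -[RHS]sum0.
by apply: eq_bigr => i _; rewrite hornerZ hornerXn mulrC.
Qed.

(** * Polyhedral cones and their rays *)

Section Rays.
Variables (R : realType) (V : vectType R) (I : finType) (a : I -> {scalar V}).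

Definition cone : set V := [set x | forall i, 0 <= a i x]%classic.

Definition lineality : set V := [set x | forall i, a i x = 0]%classic.

Local Notation L := lineality.

Definition combination (g : I -> R) (x : V) : R := \sum_i g i * a i x.

Lemma combination_is_linear g : scalar (combination g).
Proof.
move=> t x y; rewrite /combination mulr_sumr -big_split; apply: eq_bigr => i _.
by rewrite linearP /=; ring.
Qed.

HB.instance Definition _ g :=
  GRing.isLinear.Build R V R *%R (combination g) (combination_is_linear g).

Local Notation height := (combination (fun=> 1)).

Lemma lineality_linear t x y : L x -> L y -> L (t *: x + y).
Proof. by move=> Lx Ly i; rewrite linearP /= Lx Ly mulr0 addr0. Qed.

Lemma lineality0 : L 0. Proof. by move=> i; rewrite linear0. Qed.

Lemma lineality_combination g x : L x -> combination g x = 0.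
Proof. by move=> Lx; apply: big1 => i _; rewrite Lx mulr0. Qed.

Lemma cosetP u v : coset L u = coset L v <-> L (u - v).
Proof.
split=> [uv | Luv].
  by rewrite -[L (u - v)]/(coset L v u) -uv /coset /= subrr; exact: lineality0.
apply/seteqP; split=> w /= Lw i; move: (Luv i) (Lw i); rewrite !linearB /=; lra.
Qed.

Lemma half_line_eq t x z : 0 < t -> L (z - t *: x) ->
  half_line L z = half_line L x.
Proof.
move=> t0 Lzx; apply/seteqP; split=> _ [s /= s0 <-].
  exists (s * t); first by rewrite /= mulr_ge0 // ltW.
  apply/cosetP => i; move: (Lzx i); rewrite !linearB !linearZ /= => H.
  by apply/eqP; rewrite subr_eq0 -mulrA; apply/eqP; congr (_ * _); lra.
exists (s / t); first by rewrite /= divr_ge0 // ltW.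
apply/cosetP => i; move: (Lzx i); rewrite !linearB !linearZ /= => H.
have -> : a i z = t * a i x by lra.
by rewrite mulrA divfK ?subrr // gt_eqF.
Qed.

Lemma height_gt0 x : cone x -> ~ L x -> 0 < height x.
Proof.
move=> Cx nLx; have ge0 i : 0 <= 1 * a i x by rewrite mul1r; exact: Cx.
rewrite lt0r sumr_ge0 // andbT; apply/eqP => /eqP.
rewrite psumr_eq0 // => /allP H; apply: nLx => i.
by have := H i (mem_index_enum i); rewrite /= mul1r => /eqP.
Qed.

Lemma spans_ray_notin x : spans_ray cone L x -> ~ L x.
Proof. by case=> _ H _ Lx; apply: H; apply/cosetP; rewrite subr0. Qed.

(** If [y] satisfies the equations that are tight at [x], then [M *: x + y] and
    [M *: x - y] both lie in the cone for large [M]; their sum is a multiple of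
    [x], and extremality puts them on the ray. *)
Lemma spans_ray_tight x y : spans_ray cone L x ->
  (forall i, a i x = 0 -> a i y = 0) -> exists t, L (y - t *: x).
Proof.
case=> Cx _ ext tight.
(* A crude common bound for the ratios of [`|a i y|] to [a i x]. *)
pose M := 1 + \sum_i `|a i y| / a i x.
have term_ge0 i : 0 <= `|a i y| / a i x by rewrite divr_ge0.
have M_gt0 : 0 < M by rewrite ltr_pwDl // sumr_ge0.
have bound i : `|a i y| <= M * a i x.
  have [ax0|ax0] := eqVneq (a i x) 0; first by rewrite tight // ax0 normr0 mulr0.
  have ax_gt0 : 0 < a i x by rewrite lt0r ax0 Cx.
  rewrite -ler_pdivrMr // /M (bigD1 i) //= addrCA lerDl addr_ge0 //.
  exact: sumr_ge0.
pose c := (2 * M)^-1; have c_gt0 : 0 < c by rewrite invr_gt0 mulr_gt0.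
have part s : s ^+ 2 = 1 -> cone (c *: (M *: x + s *: y)).
  move=> /eqP; rewrite sqrf_eq1 => /orP sP i; move: (bound i).
  rewrite linearZ linearD !linearZ /= => bi; rewrite pmulr_rge0 //.
  move: bi; rewrite ler_norml => /andP[b1 b2].
  by case: sP => /eqP ->; lra.
have [||//|[s _ /esym/cosetP Ls] _] :=
  ext _ _ (part 1 _) (part (-1) _); rewrite ?expr1n ?sqrrN ?expr1n //.
  congr coset; rewrite -scalerDr addrACA -scalerDl -scalerDl subrr scale0r addr0.
  rewrite scalerA (_ : c * (M + M) = 1) ?scale1r // /c.
  by field; rewrite gt_eqF.
exists ((s - c * M) / c) => i; move: (Ls i).
rewrite !linearB !linearZ !linearD !linearZ /= => H.
have c_neq0 : c != 0 by rewrite gt_eqF.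
by apply: (mulfI c_neq0); rewrite mulr0 -[RHS]H; field.
Qed.

(** * Expansion of a generic functional at a ray *)

(** A set of tight inequalities which determines the ray of [x]. *)
Definition spanning (x : V) (B : {set I}) : bool :=
  [forall i in B, a i x == 0] &&
  `[< forall y, (forall i, i \in B -> a i y = 0) -> exists t, L (y - t *: x) >].

(** For [M = B :\ i] with [B] a minimal spanning set, such a [y] is the element
    of the basis dual to the [a j], [j] in [B], that belongs to [i], up to a
    scalar and modulo the lineality space: it is the direction inside the slice
    of constant height that opens up when the inequality [i] is released. *)
Definition critical (M : {set I}) (y : V) : Prop :=
  [/\ forall j, j \in M -> a j y = 0, height y = 0 & ~ L y].

(** When [B :\ i] no longer determines the ray, its common zero set contains a
    vector off the line of [x]; a multiple of [x] corrects its height to [0]. *)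
Lemma minimal_tight_set x : spans_ray cone L x ->
  exists2 B, spanning x B & forall i, i \in B -> exists y, critical (B :\ i) y.
Proof.
move=> ray_x; have h_gt0 : 0 < height x.
  by apply: height_gt0; [case: ray_x | exact: spans_ray_notin].
have [|B /minsetP[sB minB]] := @ex_minset _ (spanning x).
  exists [set i | a i x == 0]%SET; apply/andP; split.
    by apply/forall_inP => i; rewrite inE.
  apply/asboolP => y y0; apply: spans_ray_tight => // i /eqP ax0.
  by apply: y0; rewrite inE.
exists B => // i iB.
have /negP : ~~ spanning x (B :\ i).
  apply/negP => s'; have := minB _ s' (subD1set _ _) => /setP/(_ i).
  by rewrite !inE iB eqxx.
have /andP[/forall_inP tightB _] := sB.
rewrite /spanning (_ : [forall i0 in _, _] = true) /=; last first.
  by apply/forall_inP => j /setD1P[_ /tightB].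
move=> /negP/asboolPn/existsNP[y /not_implyP[y0 /forallNP yNx]].
exists (y - (height y / height x) *: x); split.
- move=> j jB; rewrite linearB linearZ /= y0 // sub0r.
  by have /setD1P[_ /tightB/eqP ->] := jB; rewrite mulr0 oppr0.
- by rewrite linearB linearZ /= divfK ?subrr // gt_eqF.
- exact: yNx.
Qed.

Lemma dual_family_card (B : {set I}) (y : I -> V) :
  {in B, forall i, a i (y i) != 0} ->
  {in B &, forall i j, i != j -> a j (y i) = 0} -> (#|B| <= \dim {:V})%N.
Proof.
move=> diag off; pose X := [tuple y (enum_val i) | i < #|B|].
suff /eqP dimX : free X by rewrite -(size_tuple X) -dimX dimvS // subvf.
apply/freeP => k sum0 i; have := congr1 (a (enum_val i)) sum0.
rewrite /= linear0 linear_sum (bigD1 i) //= big1 ?addr0 => [|j ji].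
  rewrite linearZ /= (nth_map i) ?size_enum_ord // nth_ord_enum => /eqP.
  by rewrite mulf_eq0 => /orP[/eqP //|]; rewrite (negPf (diag _ (enum_valP i))).
rewrite linearZ /= (nth_map i) ?size_enum_ord // nth_ord_enum.
by rewrite off ?mulr0 ?enum_valP // (inj_eq enum_val_inj).
Qed.

(** One representative [Y M] is enough for each [M].  This keeps the conditions
    on [g] finite in number, whereas the critical vectors are infinitely many. *)
Definition generic (g : I -> R) : Prop :=
  exists Y : {set I} -> V, forall M y, critical M y ->
    critical M (Y M) /\ combination g (Y M) != 0.

Lemma generic_exists : exists g, generic g.
Proof.
have /choice[Y YP] (M : {set I}) :
    exists y, forall z, critical M z -> critical M y.
  have [[y cy]|nocrit] := pselect (exists y, critical M y).
    by exists y.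
  by exists 0 => z cz; case: nocrit; exists z.
have [g gP] := generic_coefficients (fun M i => a i (Y M)).
exists g, Y => M y /YP cM; split=> //; apply: gP; apply: contrapT => /forallNP Y0.
by case: cM => _ _; apply=> i; have /negP := Y0 i; rewrite negbK => /eqP.
Qed.

Section Optimum.
Variable g : I -> R.
Hypothesis g_generic : generic g.
Local Notation c := (combination g).

(** The coefficients are explicit: evaluating at the dual vector [y i] gives
    [lam i = c (y i) / a i (y i)], which is nonzero by genericity.  For any [z],
    subtracting its components along the [y i] leaves a vector on which all of
    [B] vanishes, hence one proportional to [x] modulo the lineality space.  The
    dual vectors are linearly independent, which bounds [#|B|]. *)
Lemma ray_expansion x : spans_ray cone L x ->
  exists B lam, [/\ spanning x B, {in B, forall i, lam i != 0},
    (#|B| <= \dim {:V})%N &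
    forall z, height x * c z =
      height z * c x + height x * \sum_(i in B) lam i * a i z].
Proof.
move=> ray_x; have h_gt0 : 0 < height x.
  by apply: height_gt0; [case: ray_x | exact: spans_ray_notin].
have [B sB minB] := minimal_tight_set ray_x.
have /andP[/forall_inP tightB /asboolP spanB] := sB.
have [Y YP] := g_generic; pose y i := Y (B :\ i).
have crit i : i \in B -> critical (B :\ i) (y i) /\ c (y i) != 0.
  by move=> /minB[z]; exact: YP.
(* Otherwise all of [B] would vanish at [y i], whose height is [0]. *)
have diag : {in B, forall i, a i (y i) != 0}.
  move=> i iB; have [[y0 hy nLy] _] := crit i iB.
  apply/eqP => ay0; have [|t Lt] := spanB (y i).
    by move=> j jB; have [->//|ji] := eqVneq j i; apply: y0; rewrite !inE ji.
  have := lineality_combination (fun=> 1) Lt.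
  rewrite linearB linearZ /= hy sub0r => /eqP.
  rewrite oppr_eq0 mulf_eq0 (gt_eqF h_gt0) orbF => /eqP t0.
  by apply: nLy; rewrite t0 scale0r subr0 in Lt.
have off : {in B &, forall i j, i != j -> a j (y i) = 0}.
  move=> i j iB jB ij; have [[y0 _ _] _] := crit i iB.
  by apply: y0; rewrite !inE jB eq_sym ij.
exists B, (fun i => c (y i) / a i (y i)); split => //.
- by move=> i iB; rewrite mulf_neq0 ?invr_neq0 ?diag //; have [] := crit i iB.
- exact: dual_family_card diag off.
move=> z; pose z' := z - \sum_(i in B) (a i z / a i (y i)) *: y i.
have [|t Lt] := spanB z'.
  move=> j jB; rewrite linearB linear_sum (bigD1 j) //= big1 => [|i /andP[iB ij]].
    by rewrite linearZ /= divfK ?diag // addr0 subrr.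
  by rewrite linearZ /= (off i j) ?mulr0.
have := lineality_combination (fun=> 1) Lt.
have := lineality_combination g Lt.
rewrite !linearB !linear_sum !linearZ /=.
rewrite [X in _ - X - _ = 0 -> _ = 0 -> _]
  (eq_bigr (fun i => c (y i) / a i (y i) * a i z)); last first.
  by move=> i _; rewrite linearZ /=; ring.
rewrite [X in _ -> _ - X - _ = 0 -> _]big1 => [|i iB]; last first.
  by rewrite linearZ /=; have [[_ -> _] _] := crit i iB; rewrite mulr0.
set S := \sum_(i in B) _; move=> cz hz.
have -> : height z = t * height x by lra.
have -> : c z = S + t * c x by lra.
ring.
Qed.

(** * Rays as unique optima on faces *)

(** [x] minimizes [c] (for [s = false]) or maximizes it (for [s = true]) on the
    face of [N], and does so only on its own line.  Multiplying through by the
    heights expresses this on the cone itself instead of the slice of height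
    [1]. *)
Definition optimal (s : bool) (N : {set I}) (x : V) : Prop :=
  forall z, cone z -> (forall i, i \in N -> a i z = 0) ->
    height z * ((-1) ^+ s * c x) <= height x * ((-1) ^+ s * c z) /\
    (height z * ((-1) ^+ s * c x) = height x * ((-1) ^+ s * c z) ->
      exists t, L (z - t *: x)).

(** On the face where the [a i] of negative coefficient vanish, the expansion of
    [c] exceeds its value at [x] by a nonnegative combination of the remaining
    [a i], [i] in [B]; as the coefficients are nonzero, equality forces all of
    [B] to vanish.  Changing the sign of [c] exchanges the roles of positive and
    negative coefficients, so one choice of sign needs at most half of [B]. *)
Lemma ray_optimal k x : (\dim {:V} <= k.*2)%N -> spans_ray cone L x ->
  exists s (N : {set I}),
    [/\ (#|N| <= k)%N, forall i, i \in N -> a i x = 0 & optimal s N x].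
Proof.
move=> dimV ray_x; have h_gt0 : 0 < height x.
  by apply: height_gt0; [case: ray_x | exact: spans_ray_notin].
have [B [lam [/andP[/forall_inP tightB /asboolP spanB] lam0 cardB expand]]] :=
  ray_expansion ray_x.
pose N (s : bool) := [set i in B | (-1) ^+ s * lam i < 0]%SET.
have [s Ns] : exists s, (#|N s| <= k)%N.
  have NN : (#|N false| + #|N true| <= k.*2)%N.
    apply: leq_trans (leq_trans cardB dimV).
    rewrite -cardsUI (_ : N false :&: N true = finset.set0) ?cards0 ?addn0.
      apply/subset_leq_card/fintype.subsetP => i.
      by rewrite !inE => /orP[] /andP[].
    apply/setP => i; rewrite !inE; apply/negP => /andP[/andP[_ p] /andP[_ q]].
    by move: p q; rewrite expr0 expr1; lra.
  have [Nf|Nf] := leqP #|N false| k; first by exists false.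
  by exists true; lia.
exists s, (N s); split=> // [i|z Cz Nz]; first by rewrite inE => /andP[/tightB/eqP].
pose term i := (-1) ^+ s * lam i * a i z.
have term_ge0 i : i \in B -> 0 <= term i.
  move=> iB; rewrite /term; have [neg|nneg] := ltP ((-1) ^+ s * lam i) 0.
    by rewrite Nz ?mulr0 // inE iB.
  by rewrite mulr_ge0.
have sum_term : height x * ((-1) ^+ s * c z) =
    height z * ((-1) ^+ s * c x) + height x * \sum_(i in B) term i.
  rewrite mulrCA expand mulrDr mulrCA; congr (_ + _); rewrite mulrCA; congr (_ * _).
  by rewrite mulr_sumr; apply: eq_bigr => i _; rewrite /term mulrA.
rewrite sum_term; split; first by rewrite lerDl mulr_ge0 ?(ltW h_gt0) ?sumr_ge0.
move=> /eqP; rewrite eq_sym addrC -subr_eq0 addrK mulf_eq0 gt_eqF //=.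
rewrite psumr_eq0 // => /allP zero; apply: spanB => i iB.
have := zero i (mem_index_enum i); rewrite iB /= /term !mulf_eq0 signr_eq0.
by rewrite (negPf (lam0 i iB)) => /eqP.
Qed.

(** Two rays with the same code lie on each other's face, so each is optimal at
    the other. *)
Lemma optimal_half_line s (N : {set I}) x z :
  spans_ray cone L x -> spans_ray cone L z ->
  (forall i, i \in N -> a i x = 0) -> (forall i, i \in N -> a i z = 0) ->
  optimal s N x -> optimal s N z -> half_line L z = half_line L x.
Proof.
move=> ray_x ray_z Nx Nz opt_x opt_z.
have [Cx _ _] := ray_x; have [Cz _ _] := ray_z.
have hx := height_gt0 Cx (spans_ray_notin ray_x).
have hz := height_gt0 Cz (spans_ray_notin ray_z).
have [le_xz eq_xz] := opt_x z Cz Nz; have [le_zx _] := opt_z x Cx Nx.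
have [|t Lt] := eq_xz; first by apply/eqP; rewrite eq_le le_xz le_zx.
have := lineality_combination (fun=> 1) Lt; rewrite linearB linearZ /= => ht.
apply: (@half_line_eq t) => //; rewrite -(pmulr_lgt0 _ hx).
by have -> : t * height x = height z by lra.
Qed.

End Optimum.

(** An upper bound for the number of rays of a cone by the number of sets of at
    most half the dimension many inequalities; the factor [2] is the choice
    between minimum and maximum. *)
Theorem card_rays_le k : (\dim {:V} <= k.*2)%N ->
  finite_set (rays cone L) /\
  (#|` fset_set (rays cone L)| <= 2 * 'C(#|I| + k, k))%N.
Proof.
move=> dimV; have [g g_generic] := generic_exists.
pose codes (r : set (set V)) (p : bool * {set I}) := exists x,
  [/\ spans_ray cone L x, half_line L x = r, forall i, i \in p.2 -> a i x = 0,
     (#|p.2| <= k)%N & optimal g p.1 p.2 x].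
have /choice[code codeP] : forall r, exists p, rays cone L r -> codes r p.
  move=> r; have [[x ray_x <-]|not_ray] := pselect (rays cone L r); last first.
    by exists (false, finset.set0).
  have [s [N [Nk Nx opt]]] := ray_optimal g_generic dimV ray_x.
  by exists (s, N) => _; exists x.
pose D := finset.setX [set: bool]%SET [set N : {set I} | (#|N| <= k)%N]%SET.
have [||fin le] := @inj_in_card_fset_set _ _ (rays cone L) D code.
- by move=> r /codeP[x [_ _ _ Nk _]]; rewrite !inE.
- move=> r r' /set_mem/codeP[x [ray_x <- Nx _ opt_x]].
  move=> /set_mem/codeP[z [ray_z <- Nz _ opt_z]] eq_code.
  rewrite -eq_code in Nz opt_z.
  by rewrite (optimal_half_line ray_x ray_z Nx Nz opt_x opt_z).
split=> //; apply: leq_trans le _.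
by rewrite cardsX cardsT card_bool leq_mul2l card_small_sets orbT.
Qed.

End Rays.

(** * The submodular cone by local inequalities *)

Section Submodular.
Variables (R : realType) (n : nat).
Local Notation V := {ffun {set 'I_n} -> R^o}.

(** A pair [(P, T)] is the square of the Boolean lattice with bottom [T], top
    [P :|: T] and the two sets [i |: T], [i] in [P], in the middle.  Keeping [P]
    unordered counts each local inequality once; the factor [2] lost with
    ordered pairs would spoil the final estimate. *)
Definition square : finType :=
  {p : {set 'I_n} * {set 'I_n} | (#|p.1| == 2%N) && [disjoint p.1 & p.2]}.

Definition defect (q : square) (f : V) : R :=
  let: (P, T) := val q in \sum_(i in P) f (i |: T)%SET - f (P :|: T)%SET - f T.

Lemma defect_is_linear q : scalar (defect q).
Proof.
case: q => [[P S] ?] t f h; rewrite /defect /=.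
under eq_bigr => i _ do rewrite !ffunE.
by rewrite big_split -scaler_sumr !ffunE /= /GRing.scale /=; ring.
Qed.

HB.instance Definition _ q :=
  GRing.isLinear.Build R V R *%R (defect q) (defect_is_linear q).

Lemma card_square : (#|square| = 'C(n, 2) * 2 ^ (n - 2))%N.
Proof.
rewrite card_sig -sum1_card.
rewrite -[LHS](pair_big_dep (fun P : {set 'I_n} => #|P| == 2%N)
  (fun P S : {set 'I_n} => [disjoint P & S]) (fun _ _ => 1%N)) /=.
rewrite (eq_bigr (fun=> 2 ^ (n - 2)))%N => [|P /eqP cardP].
  rewrite sum_nat_const -[n in 'C(n, _)]card_ord -card_draws; congr (_ * _)%N.
  by apply: eq_card => P; rewrite inE.
have -> : (n - 2 = #|~: P|)%N.
  by have := cardsC P; rewrite card_ord cardP; lia.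
rewrite -card_powerset -sum1_card.
by apply: eq_bigl => S; rewrite inE finset.subsets_disjoint finset.setCK disjoint_sym.
Qed.

(** Adding up squares, the marginal value of an element decreases as the set
    grows; the elements of [A :\: B] are then added one at a time to both
    [A :&: B] and [B]. *)
Lemma local_submodular (f : V) :
  (forall (S : {set 'I_n}) i j, i != j -> i \notin S -> j \notin S ->
    f (i |: (j |: S)) + f S <= f (i |: S) + f (j |: S))%SET ->
  submodular_cone R n f.
Proof.
move=> loc.
have marginal m (S T : {set 'I_n}) i : #|T :\: S| = m -> S \subset T -> i \notin T ->
    f (i |: T)%SET - f T <= f (i |: S)%SET - f S.
  elim: m T => [|m IH] T cardT ST iT.
    rewrite (_ : T = S) //; apply/eqP; rewrite finset.eqEsubset ST andbT.
    by rewrite -finset.setD_eq0 -cards_eq0 cardT.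
  have /card_gt0P[j] : (0 < #|T :\: S|)%N by rewrite cardT.
  rewrite !inE => /andP[jS jT].
  have iT' : i \notin T :\ j by rewrite !inE negb_and iT orbT.
  have ij : i != j by apply: contraNneq iT => ->.
  have jT' : j \notin T :\ j by rewrite !inE eqxx.
  have ST' : S \subset T :\ j by rewrite finset.subsetD1 ST.
  have cardT' : #|(T :\ j) :\: S| = m.
    rewrite finset.setDDl finset.setUC -finset.setDDl; have := cardsD1 j (T :\: S).
    by rewrite cardT !inE jS jT => -[].
  have := loc _ i j ij iT' jT'; have := IH _ cardT' ST' iT'.
  by rewrite (finset.setD1K jT); lra.
move=> A B; elim: {A}#|A :\: B|%SET {-2}A (erefl #|A :\: B|%SET) => [|m IH] A cardA.
  have AB : A \subset B by rewrite -finset.setD_eq0 -cards_eq0 cardA.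
  by rewrite (finset.setUidPr AB) (finset.setIidPl AB) addrC.
have /card_gt0P[j] : (0 < #|A :\: B|)%N by rewrite cardA.
rewrite !inE => /andP[jB jA].
have cardA' : #|(A :\ j) :\: B| = m.
  rewrite finset.setDDl finset.setUC -finset.setDDl; have := cardsD1 j (A :\: B).
  by rewrite cardA !inE jB jA => -[].
have jA' : j \notin (A :\ j) :|: B by rewrite !inE eqxx.
have := marginal _ (A :\ j) _ j erefl (finset.subsetUl _ B) jA'.
rewrite finset.setUA (finset.setD1K jA); have := IH _ cardA'.
rewrite (_ : (A :\ j) :&: B = A :&: B); first lra.
apply/setP => i; rewrite !inE.
by have [->|//] := eqVneq i j; rewrite (negPf jB) !andbF.
Qed.

Lemma submodular_coneE : submodular_cone R n = cone defect.
Proof.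
apply/seteqP; split=> f.
  move=> sub [[P S] /= PS]; rewrite /defect /=.
  have /andP[/cards2P[i [j [ij ->]]] _] := PS.
  rewrite big_setU1 ?inE //= big_set1.
  have := sub (i |: S)%SET (j |: S)%SET.
  rewrite finset.setUACA finset.setUid -finset.setUIl.
  rewrite (_ : [set i] :&: [set j] = finset.set0) ?finset.set0U; first lra.
  by apply/setP => l; rewrite !inE; apply: contraNF ij => /andP[/eqP <- /eqP <-].
move=> Cf; apply: local_submodular => S i j ij iS jS.
have ok : (#|[set i; j]%SET| == 2%N) && [disjoint [set i; j]%SET & S].
  rewrite cards2 ij -setI_eq0; apply/eqP/setP => l; rewrite !inE.
  by apply/negP => /andP[/orP[]/eqP ->]; apply/negP.
have := Cf (exist _ ([set i; j]%SET, S) ok); rewrite /= /defect /=.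
by rewrite big_setU1 ?inE //= big_set1 finset.setUA; lra.
Qed.

Lemma modular_functionsE : modular_functions R n = lineality defect.
Proof.
have opp f : cone defect f -> cone defect (- f) -> lineality defect f.
  by move=> C1 C2 q; move: (C1 q) (C2 q); rewrite linearN /=; lra.
apply/seteqP; split=> f.
  move=> modf; apply: opp; rewrite -submodular_coneE => A B; rewrite ?ffunE.
    by have := modf A B; rewrite /=; lra.
  by move: (modf A B); rewrite /=; lra.
move=> Lf A B.
have : submodular_cone R n f by rewrite submodular_coneE => q; rewrite Lf.
move=> /(_ A B).
have : submodular_cone R n (- f).
  by rewrite submodular_coneE => q; rewrite linearN /= Lf oppr0.
move=> /(_ A B); rewrite !ffunE; lra.
Qed.

Lemma submodular_rays_count k : (2 ^ n <= k.*2)%N ->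
  finite_set (submodular_rays R n) /\
  (num_submodular_rays R n <= 2 * 'C('C(n, 2) * 2 ^ (n - 2) + k, k))%N.
Proof.
move=> nk; rewrite /num_submodular_rays /submodular_rays.
rewrite submodular_coneE modular_functionsE -card_square.
apply: card_rays_le.
by rewrite dimvf /dim /= muln1 -cardsT -powersetT card_powerset cardsT card_ord.
Qed.

End Submodular.

(** * The numerical estimate *)

Lemma expn_fact_le k m : (k ^ m * k`! <= (k + m)`!)%N.
Proof.
elim: m => [|m IH]; first by rewrite mul1n addn0.
by rewrite addnS factS expnS -mulnA leq_mul // leqW ?leq_addr.
Qed.

(** A weak form of Stirling's bound, restricted to powers of [2] so that the
    induction doubles [k]: [(2 * k)`! >= k ^ k * k`!] is then all it takes. *)
Lemma double_expn_le_fact m : (2 * (2 ^ m) ^ (2 ^ m) <= 4 ^ (2 ^ m) * (2 ^ m)`!)%N.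
Proof.
elim: m => [//|m]; rewrite expnS; set k := (2 ^ m)%N => IH.
have fact2 := expn_fact_le k k; rewrite addnn -mul2n in fact2.
have sqr x : (x ^ (2 * k) = x ^ k * x ^ k)%N by rewrite mul2n -addnn expnD.
apply: (@leq_trans (4 ^ (2 * k) * (k ^ k * k`!))); last first.
  by rewrite leq_mul2l fact2 orbT.
have -> : (2 * (2 * k) ^ (2 * k) = 4 ^ k * k ^ k * (2 * k ^ k))%N.
  by rewrite sqr -!expnMn (_ : 2 * k * (2 * k) = 4 * k * k)%N ?expnMn; lia.
have -> : (4 ^ (2 * k) * (k ^ k * k`!) = 4 ^ k * k ^ k * (4 ^ k * k`!))%N.
  by rewrite sqr; lia.
by rewrite leq_mul2l IH orbT.
Qed.

Lemma ffact_le_expn m k : (m ^_ k <= m ^ k)%N.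
Proof.
by elim: k => [//|k IH]; rewrite ffactnSr expnSr leq_mul // leq_subr.
Qed.

(** Bounding the falling factorial of [M = m + k] by [M ^ k], it remains to see
    that [2 * (4 * M) ^ k <= n ^ (2 * k) * (4 ^ k * k`!)], which follows from
    [4 * M <= n ^ 2 * k]; this last inequality says [4 <= n]. *)
Lemma double_bin_le_expn n k : (4 <= n)%N -> k = (2 ^ n.-1)%N ->
  (2 * 'C('C(n, 2) * 2 ^ (n - 2) + k, k) <= n ^ (2 ^ n))%N.
Proof.
move=> n4 kE; set M := ('C(n, 2) * _ + k)%N.
have k2 : (2 ^ n = 2 * k)%N by rewrite kE -expnS prednK //; lia.
have k2' : (2 * 2 ^ (n - 2) = k)%N by rewrite kE -expnS; congr expn; lia.
have M4 : (4 * M <= n ^ 2 * k)%N.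
  have C2 : ('C(n, 2) * 2 = n * n.-1)%N.
    by rewrite -[2%N]/(2`!)%N bin_ffact ffactnS ffactn1.
  have -> : (4 * M = (n * n.-1 + 4) * k)%N by rewrite -C2 -k2' /M -k2'; lia.
  by rewrite leq_mul2r; apply/orP; right; nia.
have pos : (0 < 4 ^ k * k`!)%N by rewrite muln_gt0 expn_gt0 fact_gt0.
rewrite -(leq_pmul2r pos) k2 expnM.
apply: (@leq_trans (2 * (4 * M) ^ k)).
  have := ffact_le_expn M k; rewrite -bin_ffact expnMn => leM.
  by rewrite -mulnA leq_mul2l /= mulnCA leq_mul2l leM orbT.
apply: (@leq_trans ((n ^ 2) ^ k * (2 * k ^ k))).
  by rewrite mulnCA -expnMn leq_mul2l /= leq_exp2r ?M4 // kE expn_gt0.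
by rewrite leq_mul2l kE double_expn_le_fact orbT.
Qed.

Theorem proposition3p26 (R : realType) (n : nat) (hn : (4 <= n)%N) :
  finite_set (submodular_rays R n) /\
  (num_submodular_rays R n <= n ^ (2 ^ n))%N.
Proof.
have dim_le : (2 ^ n <= (2 ^ n.-1).*2)%N by rewrite -mul2n -expnS prednK //; lia.
have [fin le] := @submodular_rays_count R n _ dim_le.
by split=> //; exact: leq_trans le (double_bin_le_expn hn erefl).
Qed.
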